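(* Let $m\ge 0$ be an integer, and let $\mathcal{T}$ be an arbitrary finite tree with vertex set $\mathcal{V}$ and geodesic distance $\mathcal{S}$. For an integer $t\ge 1$, let $\mathcal{T}^{\star}_{t}$ be the tree obtained from $\mathcal{T}$ by applying the $(1,m)$-star-fractal operation $t$ times, and let $\mathcal{S}^{\star}_{t}$ be its geodesic distance. Then $$\mathcal{S}^{\star}_{t}=2^{t}(m+2)^{2t}\mathcal{S}-(2^{t}-1)(m+2)^{2t-1}\left(|\mathcal{V}|^{2}-2|\mathcal{V}|+1\right)-\frac{(m+1)(|\mathcal{V}|-1)}{2}\times\frac{2^{t+1}(m+2)^{2t}-2(m+2)^{t}}{2(m+2)-1}.$$
   Context: The geodesic distance of a finite connected graph $\mathcal{G}$ with vertex set $\mathcal{V}$ is the total $\mathcal{S}=\sum_{\{u,v\}} d_{uv}$, summed over all unordered pairs of distinct vertices $u,v\in\mathcal{V}$, where $d_{uv}$ is the number of edges of a shortest path joining $u$ and $v$. The $(1,m)$-star-fractal operation on a graph does the following to every edge $uv$: it inserts a new vertex $w$ into the edge (replacing $uv$ by the path $uwv$), and attaches $m$ further new vertices $w_1,\dots,w_m$ to $w$, each by an edge to $w$ (all new vertices distinct for distinct edges). The case $m=0$ is first-order subdivision. Applying the operation $t$ times means iterating: each application acts on every edge of the graph produced by the previous application. *)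

(* Defs.v *)
From HB Require Import structures.
From mathcomp Require Import all_boot all_order all_algebra.
Set Implicit Arguments. Unset Strict Implicit. Unset Printing Implicit Defensive.

Record sgraph := SGraph {
  vertex :> finType;
  adj : rel vertex;
  adj_sym : symmetric adj;
  adj_irrefl : irreflexive adj
}.

Definition connected_graph (G : sgraph) : Prop :=
  0 < #|G| /\ forall u v : G, connect (@adj G) u v.

(* The size condition is needed because [:: u; v] satisfies ucycle
   whenever uv is an edge. *)
Definition acyclic_graph (G : sgraph) : Prop :=
  forall c : seq G, 2 < size c -> ~ ucycle (@adj G) c.

Definition is_tree (G : sgraph) : Prop :=
  connected_graph G /\ acyclic_graph G.

Definition path_of_length (G : sgraph) (u v : G) (n : nat) : bool :=
  [exists p : n.-tuple G,
     [&& path (@adj G) u p, last u p == v & uniq (u :: p)]].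

(* The least length of a path from u to v; every path has fewer than #|G|
   edges, and the value is #|G| when u and v are not connected. *)
Definition dist (G : sgraph) (u v : G) : nat :=
  find (path_of_length u v) (iota 0 #|G|).

(* Ordering the vertices by enum_rank counts each unordered pair of distinct
   vertices once. *)
Definition geodesic_distance (G : sgraph) : nat :=
  \sum_(u : G) \sum_(v : G | enum_rank u < enum_rank v) dist u v.

Definition edges (G : sgraph) : {set {set G}} :=
  [set [set p.1; p.2] | p in [pred p : G * G | adj p.1 p.2]].

Definition edge (G : sgraph) : finType := {E : {set G} | E \in edges G}.

Section StarFractal.
Variables (m : nat) (G : sgraph).

(* inr (E, None) is the vertex inserted into the edge E, and inr (E, Some i)
   is the i-th leaf attached to it. *)
Definition star_vertex : finType := (G + edge G * option 'I_m)%type.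

Definition star_adj (x y : star_vertex) : bool :=
  match x, y with
  | inl u, inr (E, None) | inr (E, None), inl u => u \in val E
  | inr (E, None), inr (F, Some _) | inr (E, Some _), inr (F, None) => E == F
  | _, _ => false
  end.

Lemma star_adj_sym : symmetric star_adj.
Proof. by move=> [u|[E [i|]]] [v|[F [j|]]] //=; rewrite eq_sym. Qed.

Lemma star_adj_irrefl : irreflexive star_adj.
Proof. by move=> [u|[E [i|]]]. Qed.

Definition star_fractal : sgraph := SGraph star_adj_sym star_adj_irrefl.

End StarFractal.

Definition iter_star_fractal (m t : nat) (G : sgraph) : sgraph :=
  iter t (star_fractal m) G.

(* Main.v *)
Require Import Defs.
From mathcomp Require Import all_boot all_order all_algebra.
From mathcomp Require Import zify ring lra.
Import GRing.Theory Num.Theory.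

(** Write x = m + 2, and let e = |V| - 1 be the number of edges of a tree.
    One application of the operation multiplies e by x, and turns the geodesic
    distance S into
      S' = 2 x^2 S - x e^2 - (m + 1) x e          (geodesic_distance_star).
    Solving this recurrence along e, x e, x^2 e, ... gives the closed form.

    The one-step formula follows from explicit distances in the new tree T'.
    Let E = ab and F = cd be edges with inserted vertices w_E and w_F.
    - Two old vertices move twice as far apart: d'(u, v) = 2 d(u, v).
    - A tree is bipartite, so d(u, a) and d(u, b) differ by one, and
      d'(u, w_E) = 2 min (d(u, a), d(u, b)) + 1 = d(u, a) + d(u, b).
    - If E <> F, both ends of E see the same end of F as the nearer one
      (edge_same_side), so d'(w_E, w_F) is half the sum of the four distances
      between an end of E and an end of F.
    - A pendant vertex is one step further away than the vertex that carries it.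
    These values are verified by a local test: a function on the vertices is the
    distance from u as soon as it vanishes at u, is 1-Lipschitz along edges, and
    can be decreased by one at every vertex other than u (dist_unique).

    All sums then reduce to sums over edges of the distances to both ends.  In a
    tree rooted at u, every edge joins a unique vertex v <> u to its parent, at
    distance d(u, v) - 1, whence (sum_dist_edges)
      sum_(ab edge) (d(u, a) + d(u, b)) = 2 sum_v d(u, v) - e.

    Trees enter through a condition that is easy to transport along the
    operation: connected, with fewer edges than vertices. *)

Set Implicit Arguments.
Unset Strict Implicit.

(** * Distances in connected graphs *)

Section Distance.
Context {G : sgraph}.
Implicit Types (u v w a b c d : G) (p : seq G).

Lemma path_of_lengthP u v n :
  reflect (exists p, [/\ size p = n, path (@adj G) u p, last u p = v & uniq (u :: p)])
          (path_of_length u v n).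
Proof.
apply: (iffP existsP) => [[p /and3P[pp /eqP lp up]]|[p [sp pp lp up]]].
  by exists p; rewrite size_tuple.
by exists (tcast sp (in_tuple p)); rewrite val_tcast pp lp eqxx.
Qed.

Lemma dist_le_path u p : path (@adj G) u p -> dist u (last u p) <= size p.
Proof.
move=> pp; case/shortenP: (pp) => q qq uq sub_qp.
have sz_q : size q <= size p by rewrite uniq_leq_size //; case/andP: uq.
apply: leq_trans sz_q; rewrite leqNgt; apply/negP => lt_q.
have lt_qG : size q < #|G|.
  by have := card_uniqP uq; rewrite /= => <-; apply: max_card.
have := before_find 0 lt_q; rewrite nth_iota // add0n => /negbT/negP; apply.
by apply/path_of_lengthP; exists q.
Qed.

Lemma dist_path u v : connect (@adj G) u v ->
  exists p, [/\ path (@adj G) u p, last u p = v & size p = dist u v].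
Proof.
case/connectP => p pp ->; case/shortenP: (pp) => q qq uq _.
have lt_qG : size q < #|G|.
  by have := card_uniqP uq; rewrite /= => <-; apply: max_card.
have hasq : has (path_of_length u (last u q)) (iota 0 #|G|).
  apply/hasP; exists (size q); first by rewrite mem_iota.
  by apply/path_of_lengthP; exists q.
have := nth_find 0 hasq; rewrite nth_iota; last by rewrite has_find size_iota in hasq.
by case/path_of_lengthP => r [? ? ? _]; exists r.
Qed.

(** Local conditions that single out the distance from u: they can be checked
    edge by edge, without exhibiting shortest paths. *)
Definition distance_from u (f : G -> nat) : Prop :=
  [/\ f u = 0,
      forall v w, adj v w -> f w <= (f v).+1
    & forall v, v != u -> exists2 w, adj w v & f v = (f w).+1].

Lemma distance_from_path u f : distance_from u f -> forall v,
  exists p, [/\ path (@adj G) u p, last u p = v & size p = f v].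
Proof.
case=> f0 _ fS v; have [n] := ubnP (f v).
elim: n v => // n IHn v le_fv; have [->|/fS[w vw fv]] := eqVneq v u.
  by exists [::]; rewrite f0.
case: (IHn w); first by rewrite fv in le_fv.
move=> p [pp lp sp]; exists (rcons p v).
by rewrite rcons_path pp lp last_rcons size_rcons sp vw.
Qed.

(** Descending along the third condition builds a path of length f v, and the
    Lipschitz condition prevents any path from being shorter. *)
Lemma dist_unique u f : distance_from u f -> dist u =1 f.
Proof.
move=> Df v; have [p [pp lp sp]] := distance_from_path Df v.
apply/eqP; rewrite eqn_leq; apply/andP; split; first by rewrite -sp -lp dist_le_path.
have /dist_path[q [qq <- <-]] : connect (@adj G) u v by apply/connectP; exists p.
case: Df => f0 fL _; rewrite -[size q]addn0 -f0.
elim: q u qq {f0 v p pp lp sp} => //= w q IHq u /andP[uw qq].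
by apply: leq_trans (IHq _ qq) _; rewrite addSnnS leq_add2l fL.
Qed.

Lemma distance_from_connected u f : distance_from u f -> forall v, connect (@adj G) u v.
Proof.
by move=> Df v; have [p [pp <- _]] := distance_from_path Df v; apply/connectP; exists p.
Qed.

Lemma dist_distance_from u : connected_graph G -> distance_from u (dist u).
Proof.
move=> [_ cG]; split.
- by apply/eqP; rewrite -leqn0; apply: (@dist_le_path u [::]).
- move=> v w vw; have [p [pp lp <-]] := dist_path (cG u v).
  rewrite -(size_rcons p w) -[X in dist u X](last_rcons u p w) dist_le_path //.
  by rewrite rcons_path pp lp.
move=> v neq; have [p] := dist_path (cG u v); case/lastP: p => [|p x] [].
  by move=> _ /= E; rewrite E eqxx in neq.
rewrite rcons_path last_rcons size_rcons => /andP[pp px] <- {v neq} dx.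
exists (last u p) => //; apply/eqP; rewrite eqn_leq -{2}dx ltnS dist_le_path // andbT.
have [q [qq lq <-]] := dist_path (cG u (last u p)).
rewrite -(size_rcons q x) -[X in dist u X](last_rcons u q x) dist_le_path //.
by rewrite rcons_path qq lq.
Qed.

Lemma dist_sym u v : connected_graph G -> dist u v = dist v u.
Proof.
move=> [_ cG]; wlog suff: u v / dist v u <= dist u v.
  by move=> H; apply/eqP; rewrite eqn_leq !H.
have [p [pp lp <-]] := dist_path (cG u v).
have -> : size p = size (rev (belast u p)) by rewrite size_rev size_belast.
have lrev : last v (rev (belast u p)) = u.
  by case: p pp lp => //= x p _ _; rewrite rev_cons last_rcons.
rewrite -{1}lrev; apply: dist_le_path; rewrite -lp rev_path.
by rewrite (eq_path (e' := @adj G)) // => x y /=; rewrite adj_sym.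
Qed.

End Distance.

(** * Trees as sparse connected graphs *)

(** Equivalent to being a tree; counting edges is easier to carry through the
    star-fractal operation than the absence of cycles. *)
Definition sparse_connected (G : sgraph) : Prop :=
  connected_graph G /\ #|edges G| < #|G|.

(** The default v is only reached at the root u, or off its component. *)
Definition parent {G : sgraph} (u v : G) : G :=
  odflt v [pick w | adj w v & dist u v == (dist u w).+1].

Section Connected.
Context {G : sgraph} (cG : connected_graph G).
Implicit Types (u v w a b c d : G) (p : seq G).

Lemma dist_self u : dist u u = 0.
Proof. by have [] := dist_distance_from u cG. Qed.

Lemma parentP u v : v != u ->
  adj (parent u v) v /\ dist u v = (dist u (parent u v)).+1.
Proof.
move=> neq; rewrite /parent; case: pickP => [w /andP[? /eqP ?] //|/= noparent].
have [_ _ /(_ v neq)[w vw dv]] := dist_distance_from u cG.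
by have := noparent w; rewrite vw dv eqxx.
Qed.

Lemma edges_adj v w : adj v w -> [set v; w] \in edges G.
Proof. by move=> vw; apply/imsetP; exists (v, w). Qed.

Lemma parent_edges_sub u : [set [set v; parent u v] | v in [set~ u]] \subset edges G.
Proof.
apply/subsetP => E /imsetP[v]; rewrite in_setC1 => /parentP[pv _] ->.
by rewrite edges_adj // adj_sym.
Qed.

Lemma set2_eq (A : finType) (a b c d : A) : [set a; b] = [set c; d] ->
  a = c /\ b = d \/ a = d /\ b = c.
Proof.
move=> E.
have := set21 a b; rewrite E !inE => /orP[]/eqP ?;
have := set22 a b; rewrite E !inE => /orP[]/eqP ?;
have := set21 c d; rewrite -E !inE => /orP[]/eqP ?;
have := set22 c d; rewrite -E !inE => /orP[]/eqP ?; subst; auto.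
Qed.

(** If vw is the edge from v to its parent and also the edge from w to its
    parent, then v and w are each nearer to u than the other. *)
Lemma parent_edge_inj u : {in [set~ u] &, injective (fun v => [set v; parent u v])}.
Proof.
move=> v w; rewrite !in_setC1 => /parentP[_ dv] /parentP[_ dw] /set2_eq[[]//|[Ev Ew]].
by move: dv dw; rewrite Ew -Ev => ->; lia.
Qed.

Lemma card_parent_edges u :
  #|[set [set v; parent u v] | v in [set~ u]]| = #|G|.-1.
Proof. by rewrite card_in_imset ?cardsC1 //; apply: parent_edge_inj. Qed.

End Connected.

(** The edges from vertices to their parents already connect the graph.  Any
    other edge ab would close a path of such edges from a to b into a cycle;
    hence all edges are of this form, and there are at most |V| - 1 of them. *)
Lemma tree_sparse (G : sgraph) : is_tree G -> sparse_connected G.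
Proof.
move=> [cG aG]; split=> //; have [/card_gt0P[u _] _] := cG.
rewrite -(prednK (proj1 cG)) ltnS -(card_parent_edges cG u) subset_leq_card //.
apply/subsetP => _ /imsetP[[a b] /= ab ->]; rewrite inE /= in ab.
(* pe is adjacency through parent edges only *)
pose pe : rel G := fun v w => (v != u) && (w == parent u v) || (w != u) && (v == parent u w).
have pe_sym : symmetric pe by move=> v w; rewrite /pe orbC.
have pe_adj : subrel pe (@adj G).
  move=> v w /orP[]/andP[/(parentP cG)[pv _] /eqP ->] //.
  by rewrite adj_sym.
have croot v : connect pe u v.
  have [n] := ubnP (dist u v); elim: n v => // n IHn v.
  have [->|neq] := eqVneq v u; first by rewrite connect0.
  have [_ ->] := parentP cG neq; rewrite ltnS => /IHn /connect_trans -> //.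
  by apply: connect1; rewrite /pe neq eqxx orbT.
have /connectP[p0 pp0 Eb] : connect pe a b.
  by apply: connect_trans (croot b); rewrite (sym_connect_sym pe_sym).
have [pab|npab] := boolP (pe a b).
  apply/imsetP; case/orP: pab => /andP[neq /eqP ->]; first by exists a; rewrite ?inE.
  by exists b; rewrite ?inE // setUC.
case/shortenP: pp0 Eb => p pp up _ Eb; exfalso.
apply: (aG (a :: p)); last first.
  rewrite /ucycle /cycle up andbT rcons_path (sub_path pe_adj pp) -Eb.
  by rewrite adj_sym.
case: p pp up Eb => [|x [|y p]] //= pp _ Eb.
  by rewrite Eb adj_irrefl in ab.
by rewrite andbT -Eb in pp; rewrite pp in npab.
Qed.

Section SparseConnected.
Context {G : sgraph} (sG : sparse_connected G).
Implicit Types (u v w a b c d : G) (p : seq G).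
Let cG : connected_graph G := proj1 sG.

(** The |V| - 1 distinct parent edges exhaust the edges by cardinality. *)
Lemma edges_parent u : edges G = [set [set v; parent u v] | v in [set~ u]].
Proof.
apply/esym/eqP; rewrite eqEcard parent_edges_sub // card_parent_edges // -ltnS.
by rewrite (prednK (proj1 cG)); case: sG.
Qed.

Lemma card_edges : #|edges G|.+1 = #|G|.
Proof.
have [/card_gt0P[u _] _] := cG.
by rewrite (edges_parent u) card_parent_edges // (prednK (proj1 cG)).
Qed.

Lemma adj_parent u c d : adj c d ->
  (c != u /\ d = parent u c) \/ (d != u /\ c = parent u d).
Proof.
move/edges_adj; rewrite (edges_parent u) => /imsetP[v]; rewrite !inE => neq.
by case/set2_eq=> [[-> ->]|[-> ->]]; [left|right].
Qed.

(** Uniqueness of the neighbour of d that is nearer to the root u: this is what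
    distinguishes trees from general bipartite graphs. *)
Lemma adj_closer u c d : adj c d -> dist u d = (dist u c).+1 -> c = parent u d.
Proof.
move=> /(adj_parent u)[[neq ->]|[] //] E.
by have [_] := parentP cG neq; rewrite E; lia.
Qed.

Lemma adj_dist u c d : adj c d -> dist u c = (dist u d).+1 \/ dist u d = (dist u c).+1.
Proof. by case/(adj_parent u) => -[/(parentP cG)[_ ?] ->]; auto. Qed.

Lemma edge_orient u (E : edge G) :
  exists c d, [/\ val E = [set c; d], adj c d & dist u d = (dist u c).+1].
Proof.
case: E => E /= /imsetP[[c d] /= cd ->]; rewrite inE /= in cd.
case: (adj_dist u cd) => ?; [exists d, c|exists c, d]; split=> //.
- by rewrite setUC.
- by rewrite adj_sym.
Qed.

Lemma distS u v w : adj v w -> dist u w <= (dist u v).+1.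
Proof. by have [_ H _] := dist_distance_from u cG; apply: H. Qed.

Lemma dist_adj a b : adj a b -> dist a b = 1.
Proof.
move=> ab; have d0 := dist_self cG a.
by case: (adj_dist a ab); rewrite d0.
Qed.

Lemma dist_eq0 u v : dist u v = 0 -> v = u.
Proof. by move=> d0; have [//|/(parentP cG)[_]] := eqVneq v u; rewrite d0. Qed.

(** Otherwise c is nearest to a and d to b, all at matching distances, as for
    opposite edges of an even cycle.  If a = c then b = d and the two edges
    coincide.  If not, the next vertex a' from a towards c is then
    also nearer to d than a is, and so is b; uniqueness of parents makes a' = b,
    which contradicts the distances to c. *)
Lemma edge_same_side a b c d : adj a b -> adj c d -> [set a; b] <> [set c; d] ->
  dist a d = (dist a c).+1 -> dist b d = (dist b c).+1.
Proof.
move=> ab cd neq ad; case: (adj_dist b cd) => // bc; exfalso.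
have sym := fun x y => dist_sym x y cG; have ba : adj b a by rewrite adj_sym.
have dc : adj d c by rewrite adj_sym.
have := distS c ab; have := distS c ba; have := distS d ab; have := distS d ba.
rewrite !(sym _ a) !(sym _ b) => ? ? ? ?.
have Ebd : dist b d = dist a c by lia.
have [ac|nac] := eqVneq a c.
  apply: neq; move: Ebd bc; rewrite ac => E1 E2.
  have d0 := dist_self cG c.
  by rewrite d0 in E1; rewrite (dist_eq0 E1).
have [pa dpa] := parentP cG nac; set a' := parent c a in pa dpa.
have Eb : b = parent d a by apply: adj_closer => //; rewrite !(sym d); lia.
have Ea' : a' = parent d a.
  apply: adj_closer => //.
  have := distS a' cd; have := distS a' dc; have := distS d pa.
  rewrite !(sym _ a') !(sym _ a) in dpa * => ? ? ?; lia.
by move: dpa; rewrite Ea' -Eb !(sym c); lia.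
Qed.

End SparseConnected.

(** * Sums over edges *)

Lemma sum_edge (G : sgraph) (F : {set G} -> nat) :
  \sum_(E : edge G) F (val E) = \sum_(E in edges G) F E.
Proof.
rewrite [RHS](reindex_omap (val : edge G -> {set G}) insub) /=; last first.
  by move=> E EG; rewrite insubT.
by apply: eq_bigl => -[E EG] /=; rewrite EG insubT /= eqxx.
Qed.

Lemma sum_set2 (T : finType) (F : T -> nat) (a b : T) : a != b ->
  \sum_(x in [set a; b]) F x = F a + F b.
Proof. by move=> neq; rewrite big_setU1 ?big_set1 // inE. Qed.

Lemma adj_neq (G : sgraph) (a b : G) : adj a b -> a != b.
Proof. by apply: contraTneq => ->; rewrite adj_irrefl. Qed.

(** The edge from v to its parent contributes d(u, v) + (d(u, v) - 1), and each
    edge arises from exactly one v <> u. *)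
Lemma sum_dist_edges (G : sgraph) (u : G) : sparse_connected G ->
  \sum_(E : edge G) \sum_(a in val E) dist u a + #|edges G| = 2 * \sum_v dist u v.
Proof.
move=> sG; have cG := proj1 sG.
rewrite (sum_edge (fun E => \sum_(a in E) dist u a)) (edges_parent sG u).
rewrite (card_in_imset (@parent_edge_inj _ cG u)) big_imset; last exact: parent_edge_inj.
rewrite -sum1_card -big_split /= [in RHS](bigD1 u) //= (dist_self cG).
rewrite add0n big_distrr /=; apply: eq_big => [v|v]; rewrite !inE // => neq.
have [pv dv] := parentP cG neq.
by rewrite sum_set2 1?eq_sym ?adj_neq //= {1}dv; lia.
Qed.

Lemma sum_option (m : nat) (F : option 'I_m -> nat) :
  \sum_o F o = F None + \sum_(i < m) F (Some i).
Proof.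
rewrite (bigD1 None) //=; congr (_ + _).
rewrite (reindex_omap Some id) //=; last by case.
by apply: eq_bigl => i; rewrite eqxx.
Qed.

Lemma sum_star_vertex (m : nat) (G : sgraph) (F : star_fractal m G -> nat) :
  \sum_x F x = \sum_(u : G) F (inl u)
    + \sum_(E : edge G) (F (inr (E, None)) + \sum_(i < m) F (inr (E, Some i))).
Proof.
rewrite big_sumType /=; congr (_ + _).
rewrite (eq_bigr (fun E : edge G => \sum_(o : option 'I_m) F (inr (E, o)))).
  by rewrite pair_big; apply: eq_bigr => -[].
by move=> E _; rewrite sum_option.
Qed.

Lemma card_star_vertex (m : nat) (G : sgraph) :
  #|star_fractal m G| = #|G| + #|edges G| * m.+1.
Proof.
by rewrite card_sum card_prod card_option card_ord card_sig.
Qed.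

Lemma card_set_edges (G : sgraph) (E : edge G) : #|val E| = 2.
Proof.
by case: E => _ /= /imsetP[[a b] /= ab ->]; rewrite inE /= in ab; rewrite cards2 (adj_neq ab).
Qed.

(** An upper bound is enough: connectedness supplies the reverse inequality. *)
Lemma card_edges_star_le (m : nat) (G : sgraph) :
  #|edges (star_fractal m G)| <= #|edges G| * m.+2.
Proof.
set ends := [set ([set inl p.1; inr (p.2, None)] : {set star_fractal m G})
   | p in [pred p : G * edge G | p.1 \in val p.2]].
set leaves := [set ([set inr (p.1, None); inr (p.1, Some p.2)] : {set star_fractal m G})
   | p in [set: edge G * 'I_m]].
have le_ends : #|ends| <= #|edges G| * 2.
  apply: leq_trans (leq_imset_card _ _) _.
  rewrite -sum1_card -(pair_big_dep xpredT (fun a (E : edge G) => a \in val E) (fun _ _ => 1)) /=.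
  rewrite (exchange_big_dep xpredT) //=.
  rewrite (eq_bigr (fun=> 2)); last by move=> E _; rewrite sum1_card card_set_edges.
  by rewrite sum_nat_const card_sig leqnn.
have le_leaves : #|leaves| <= #|edges G| * m.
  apply: leq_trans (leq_imset_card _ _) _.
  by rewrite cardsT card_prod card_ord card_sig.
apply: (@leq_trans (#|ends| + #|leaves|)); last by lia.
apply: leq_trans (leq_card_setU _ _); apply: subset_leq_card.
apply/subsetP => _ /imsetP[[x y] /= xy ->]; rewrite !inE /= in xy *.
case: x y xy => [u|[E [i|]]] [v|[F [j|]]] //= xy; apply/orP.
- by left; apply/imsetP; exists (u, F).
- by right; apply/imsetP; exists (E, i); rewrite ?inE // (eqP xy) setUC.
- by left; apply/imsetP; exists (v, E); rewrite // setUC.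
- by right; apply/imsetP; exists (F, j); rewrite ?inE // (eqP xy).
Qed.

(** * Distances after one star-fractal operation *)

Definition dist_to_edge {G : sgraph} (u : G) (E : edge G) : nat :=
  \sum_(a in val E) dist u a.

(** The distance between the vertices inserted into E and F in the new tree.
    For E <> F the sum of the four distances between ends is even; for E = F it
    is 2, so the diagonal has to be treated apart. *)
Definition dist_edges {G : sgraph} (E F : edge G) : nat :=
  if E == F then 0 else (\sum_(b in val E) dist_to_edge b F)./2.

(** Candidate distance function on the new graph: g on old vertices, h on
    inserted vertices, and one more on pendant vertices. *)
Definition star_extension {m : nat} {G : sgraph} (g : G -> nat) (h : edge G -> nat)
    (y : star_fractal m G) : nat :=
  match y with
  | inl v => g v
  | inr (F, o) => h F + (o != None)
  end.

(** The source x0 is an old or an inserted vertex, as the value at a pendant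
    vertex is positive.  Away from the source, g must grow by two across each
    edge with h taking the value in between, and every old vertex must have an
    incident edge that leads towards the source. *)
Lemma star_extension_distance (m : nat) (G : sgraph) (x0 : star_fractal m G)
    (g : G -> nat) (h : edge G -> nat) :
  star_extension g h x0 = 0 ->
  (forall F : edge G, x0 <> inr (F, None) ->
     exists c d, [/\ val F = [set c; d], h F = (g c).+1 & g d = (g c).+2]) ->
  (forall (F : edge G) v, x0 = inr (F, None) -> v \in val F -> g v = 1) ->
  (forall v, x0 <> inl v -> exists2 F : edge G, v \in val F & g v = (h F).+1) ->
  distance_from x0 (star_extension g h).
Proof.
move=> h0 hF hF0 hv.
have step (F : edge G) v : v \in val F -> g v <= (h F).+1 /\ h F <= (g v).+1.
  have [E|/eqP /hF[c [d [-> -> gd]]]] := eqVneq x0 (inr (F, None)).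
    by move=> /(hF0 _ _ E) ->; move: h0; rewrite E /=; lia.
  by rewrite !inE => /orP[]/eqP ->; lia.
split=> //.
- move=> [u|[E [i|]]] [v|[F [j|]]] //=.
  + by move=> /step; lia.
  + by move/eqP ->; lia.
  + by move=> /step; lia.
  + by move/eqP ->; lia.
case=> [v|[F [i|]]] neq.
- have [|F vF gv] := hv v; first by move=> E; rewrite E eqxx in neq.
  by exists (inr (F, None)); rewrite //= addn0.
- by exists (inr (F, None)); rewrite /= ?eqxx // addn0 addn1.
- have [|c [d [EF hFc _]]] := hF F; first by move=> E; rewrite E eqxx in neq.
  by exists (inl c); rewrite /= ?EF ?set21 // addn0.
Qed.

Section StarDistances.
Variables (m : nat) (G : sgraph) (sG : sparse_connected G).
Let cG : connected_graph G := proj1 sG.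

Lemma dist_to_edge2 (u c d : G) (F : edge G) :
  val F = [set c; d] -> adj c d -> dist_to_edge u F = dist u c + dist u d.
Proof. by rewrite /dist_to_edge => -> /adj_neq cd; rewrite sum_set2. Qed.

Lemma edge_exists (c d : G) : adj c d -> exists F : edge G, val F = [set c; d].
Proof. by move=> /edges_adj cd; exists (exist (fun E => E \in edges G) _ cd). Qed.

Lemma distance_from_old (u : G) :
  distance_from (inl u : star_fractal m G)
    (star_extension (fun v => 2 * dist u v) (dist_to_edge u)).
Proof.
apply: star_extension_distance => //=.
- by rewrite dist_self.
- move=> F _; have [c [d [EF cd dd]]] := edge_orient sG u F.
  by exists c, d; rewrite (dist_to_edge2 u EF cd); split=> //; lia.
move=> v neq; have [|pv dv] := @parentP _ cG u v; first by apply: contra_notN neq => /eqP ->.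
have [F EF] := edge_exists pv; exists F; first by rewrite EF set22.
by rewrite (dist_to_edge2 u EF pv); lia.
Qed.

(** Since both ends of E see c as the nearer end of F, the distances to E from
    c, w_F and d are consecutive integers. *)
Lemma dist_edges_step (E F : edge G) (a b c d : G) :
  val E = [set a; b] -> adj a b -> val F = [set c; d] -> adj c d -> E <> F ->
  dist a d = (dist a c).+1 ->
  dist_edges E F = (dist_to_edge c E).+1 /\ dist_to_edge d E = (dist_to_edge c E).+2.
Proof.
move=> EE ab EF cd neq ad.
have bd : dist b d = (dist b c).+1.
  by apply: (edge_same_side sG ab cd _ ad); rewrite -EE -EF => /val_inj.
rewrite /dist_edges !(dist_to_edge2 _ EE ab) EE sum_set2 ?adj_neq //.
rewrite !(dist_to_edge2 _ EF cd) !(dist_sym c _ cG) !(dist_sym d _ cG).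
by case: eqP => // _; lia.
Qed.

Lemma distance_from_mid (E : edge G) :
  distance_from (inr (E, None) : star_fractal m G)
    (star_extension (fun v => dist_to_edge v E) (dist_edges E)).
Proof.
have [a [b [EE ab _]]] : exists a b, [/\ val E = [set a; b], adj a b & true].
  by have [/card_gt0P[u _] _] := cG; have [a [b []]] := edge_orient sG u E; exists a, b.
have gE v : v \in val E -> dist_to_edge v E = 1.
  rewrite (dist_to_edge2 v EE ab) EE !inE => /orP[]/eqP ->; rewrite dist_self //.
    by rewrite dist_adj.
  by rewrite dist_adj // adj_sym.
have hE : dist_edges E E = 0 by rewrite /dist_edges eqxx.
apply: star_extension_distance => //=.
- by rewrite hE.
- move=> F neq; have [c [d [EF cd dd]]] := edge_orient sG a F.
  have [|hF gd] := dist_edges_step EE ab EF cd _ dd; last by exists c, d.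
  by move=> EF'; apply: neq; rewrite EF'.
- by move=> F v [<-]; apply: gE.
move=> v _; have [vE|nvE] := boolP (v \in val E).
  by exists E => //; rewrite gE ?hE.
have [|pv dv] := @parentP _ cG a v; first by apply: contraNneq nvE => ->; rewrite EE set21.
have [F EF] := edge_exists pv; exists F; first by rewrite EF set22.
have [|-> ->] // := dist_edges_step EE ab EF pv _ dv.
by move=> EF'; rewrite EF' EF set22 in nvE.
Qed.

Lemma star_connected : connected_graph (star_fractal m G).
Proof.
have [/card_gt0P[u _] _] := cG.
have c := distance_from_connected (distance_from_old u).
split; first by apply/card_gt0P; exists (inl u).
move=> x y; apply: connect_trans (c y).
by rewrite (sym_connect_sym (@star_adj_sym m G)).
Qed.

Lemma star_sparse_connected : sparse_connected (star_fractal m G).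
Proof.
split; first exact: star_connected.
have := card_edges_star_le m G; have := card_edges sG; rewrite card_star_vertex; lia.
Qed.

Lemma card_edges_star : #|edges (star_fractal m G)| = #|edges G| * m.+2.
Proof.
have := card_edges star_sparse_connected; rewrite card_star_vertex -(card_edges sG).
lia.
Qed.

End StarDistances.

Lemma dist_pendant (G : sgraph) (x y z : G) : connected_graph G ->
  (forall w, adj x w = (w == y)) -> z != x -> dist x z = (dist y z).+1.
Proof.
move=> cG xy neq; have [_ _ descent] := dist_distance_from z cG.
have [|w wx] := descent x.
  by rewrite eq_sym.
rewrite !(dist_sym _ z cG) => ->; congr (dist z _).+1; apply/eqP.
by rewrite -xy adj_sym.
Qed.

(** * Distance sums after one star-fractal operation *)

Definition distance_sum {G : sgraph} (u : G) : nat := \sum_v dist u v.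
Definition total_distance (G : sgraph) : nat := \sum_(u : G) distance_sum u.

(** Summing over ordered pairs avoids the enumeration order and counts every
    unordered pair twice. *)
Lemma total_distance_geodesic (G : sgraph) : connected_graph G ->
  total_distance G = 2 * geodesic_distance G.
Proof.
move=> cG; rewrite /geodesic_distance mul2n -addnn.
rewrite {2}(exchange_big_dep xpredT) //= -big_split /=; apply: eq_bigr => u _.
rewrite /distance_sum (bigID (fun v => enum_rank u < enum_rank v)) /=; congr (_ + _).
rewrite (bigD1 u) ?ltnn //= dist_self // add0n; apply: eq_big => [v|v _]; last exact: dist_sym.
rewrite -leqNgt [RHS]ltn_neqAle andbC; congr (_ && _).
by rewrite -(inj_eq enum_rank_inj).
Qed.

Section StarSums.
Variables (m : nat) (G : sgraph) (sG : sparse_connected G).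
Let cG : connected_graph G := proj1 sG.
Let cS : connected_graph (star_fractal m G) := star_connected m sG.

Lemma card_edge : #|edge G| = #|edges G|.
Proof. exact: card_sig. Qed.

Lemma sum_star_extension (g : G -> nat) (h : edge G -> nat) :
  \sum_(y : star_fractal m G) star_extension g h y =
  \sum_v g v + m.+1 * \sum_E h E + #|edges G| * m.
Proof.
rewrite sum_star_vertex -addnA; congr (_ + _).
rewrite -card_edge big_distrr -sum_nat_const -big_split /=; apply: eq_bigr => E _.
by rewrite sum_nat_const card_ord; lia.
Qed.

Lemma distance_sum_old (u : G) :
  distance_sum (inl u : star_fractal m G) + #|edges G| = 2 * m.+2 * distance_sum u.
Proof.
rewrite /distance_sum (eq_bigr _ (fun y _ => dist_unique (distance_from_old m sG u) y)).
rewrite sum_star_extension -big_distrr /=.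
have := sum_dist_edges u sG; rewrite -[X in X + _]/(\sum_E dist_to_edge u E).
move: (\sum_E _) (\sum_v _) => s d E; rewrite mulnAC -E; ring.
Qed.

Lemma distance_sum_mid (E : edge G) :
  distance_sum (inr (E, None) : star_fractal m G) =
  \sum_v dist_to_edge v E + m.+1 * \sum_F dist_edges E F + #|edges G| * m.
Proof.
rewrite /distance_sum (eq_bigr _ (fun y _ => dist_unique (distance_from_mid m sG E) y)).
exact: sum_star_extension.
Qed.

(** Every vertex other than the pendant vertex x is one step further from x than
    from its neighbour y.  The pair x, y itself accounts for the correction 2:
    x is at distance 0 from itself and at distance 1 from y. *)
Lemma distance_sum_leaf (E : edge G) (i : 'I_m) :
  distance_sum (inr (E, Some i) : star_fractal m G) + 2 =
  #|star_fractal m G| + distance_sum (inr (E, None) : star_fractal m G).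
Proof.
set x : star_fractal m G := inr (E, Some i); set y : star_fractal m G := inr (E, None).
have xy w : adj x w = (w == y).
  rewrite /y; case: w => [u|[F [j|]]] //=.
    by apply/esym/eqP.
  by apply/eqP/eqP => [->|[]].
rewrite /distance_sum (bigD1 x) //= (dist_self cS) add0n.
rewrite (eq_bigr _ (fun z neq => dist_pendant cS xy neq)).
rewrite [in RHS](bigD1 x) //= (dist_adj (star_sparse_connected m sG)); last first.
  by rewrite adj_sym xy.
rewrite (eq_bigr (fun z => 1 + dist y z)) // big_split /=.
have -> : \sum_(z | z != x) 1 = #|star_fractal m G|.-1.
  by rewrite sum1_card; apply: (cardC1 x).
by rewrite -{2}(prednK (proj1 cS)); lia.
Qed.

Lemma sum_dist_to_edge :
  \sum_(v : G) \sum_E dist_to_edge v E + #|G| * #|edges G| = 2 * total_distance G.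
Proof.
rewrite -sum_nat_const -big_split big_distrr /=.
by apply: eq_bigr => v _; apply: sum_dist_edges.
Qed.

(** Both sides add d(v, b) over all vertices v and all ends b of edges. *)
Lemma sum_distance_sum_edges :
  \sum_(E : edge G) \sum_(b in val E) distance_sum b =
  \sum_(v : G) \sum_E dist_to_edge v E.
Proof.
rewrite exchange_big /=; apply: eq_bigr => E _.
rewrite /dist_to_edge exchange_big /=; apply: eq_bigr => b _.
by apply: eq_bigr => v _; apply: dist_sym.
Qed.

(** The term E == F makes the halved sum uniform: for E = F the sum over ends is
    2 while the distance is 0. *)
Lemma double_dist_edges (E F : edge G) :
  2 * (dist_edges E F + (E == F)) = \sum_(b in val E) dist_to_edge b F.
Proof.
have [/card_gt0P[u _] _] := cG; have [a [b [EE ab _]]] := edge_orient sG u E.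
have [EF|/eqP neq] := eqVneq E F.
  rewrite -EF /dist_edges eqxx EE sum_set2 ?adj_neq // !(dist_to_edge2 _ EE ab).
  by rewrite !dist_self // (dist_sym b a) // dist_adj.
have [c [d [EF cd dd]]] := edge_orient sG a F.
have [-> E2] := dist_edges_step sG EE ab EF cd neq dd.
rewrite EE sum_set2 ?adj_neq // !(dist_to_edge2 _ EF cd).
move: E2; rewrite !(dist_to_edge2 _ EE ab) !(dist_sym c _ cG) !(dist_sym d _ cG).
lia.
Qed.

(** Sum the previous identity over F for fixed E with the edge-sum formula at
    both ends of E, then over E by exchanging the sums. *)
Lemma sum_dist_edges_edges :
  \sum_(E : edge G) \sum_F dist_edges E F + #|edges G| + #|edges G| ^ 2
    + #|G| * #|edges G| = 2 * total_distance G.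
Proof.
have local (E : edge G) :
    2 * (\sum_F dist_edges E F + 1) + 2 * #|edges G| = 2 * \sum_(b in val E) distance_sum b.
  have -> : \sum_F dist_edges E F + 1 = \sum_F (dist_edges E F + (E == F)).
    rewrite big_split /=; congr (_ + _).
    by rewrite (bigD1 E) //= eqxx big1 // => F /negPf neq; rewrite eq_sym neq.
  rewrite big_distrr /= (eq_bigr _ (fun F _ => double_dist_edges E F)).
  rewrite exchange_big -{1}(card_set_edges E) -sum_nat_const -big_split big_distrr /=.
  by apply: eq_bigr => b _; apply: sum_dist_edges.
have := eq_bigr (op := addn) (idx := 0) (r := index_enum (edge G)) _ (fun E (_ : true) => local E).
rewrite big_split -!big_distrr big_split /= !sum_nat_const card_edge muln1 => H.
rewrite sum_distance_sum_edges in H; have := sum_dist_to_edge; move: H; rewrite -mulnn.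
move: (\sum_(v : G) _) (\sum_(E : edge G) _) #|edges G| #|G| (total_distance G).
by clear; nia.
Qed.

(** Old, inserted and pendant sources are summed separately; what remains is
    linear in the total distance once the two edge sums are eliminated. *)
Lemma total_distance_star :
  let e := #|edges G| in let x := m.+2 in
  total_distance (star_fractal m G) + 2 * x * e ^ 2 + 2 * m.+1 * x * e
  = 2 * x ^ 2 * total_distance G.
Proof.
move=> e x; rewrite {1}/total_distance sum_star_vertex.
set A := \sum_(u : G) _; rewrite big_split /=; set B := \sum_E _; set L := \sum_E _.
have HA : A + #|G| * e = 2 * x * total_distance G.
  rewrite -sum_nat_const -big_split big_distrr /=.
  by apply: eq_bigr => u _; apply: distance_sum_old.
have HB : B = \sum_(v : G) \sum_E dist_to_edge v E
    + m.+1 * (\sum_(E : edge G) \sum_F dist_edges E F) + e * (e * m).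
  rewrite /B (eq_bigr _ (fun E _ => distance_sum_mid E)) !big_split /=.
  by rewrite sum_nat_const card_edge -big_distrr [in X in X + _ + _]exchange_big.
have HL : L + \sum_(E : edge G) \sum_(i < m) 2 =
    \sum_(E : edge G) \sum_(i < m)
      (#|star_fractal m G| + distance_sum (inr (E, None) : star_fractal m G)).
  rewrite -big_split; apply: eq_bigr => E _; rewrite -big_split.
  by apply: eq_bigr => i _; apply: distance_sum_leaf.
have {}HL : L + e * (m * 2) = m * (e * #|star_fractal m G| + B).
  move: HL; under [in RHS]eq_bigr do rewrite sum_nat_const card_ord.
  by rewrite !sum_nat_const -big_distrr big_split /= sum_nat_const card_ord card_edge.
have HB1 := sum_dist_to_edge; have HQ := sum_dist_edges_edges.
(* multiples of the two relations that eliminate B1 and Q linearly *)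
have := congr1 (muln m.+1) HB1; have := congr1 (muln (m.+1 * m.+1)) HQ.
move: HL HB HA; rewrite card_star_vertex -(card_edges sG) -/e {}/x.
move: (\sum_(v : G) _) (\sum_(E : edge G) \sum_F dist_edges E F) (total_distance G) => B1 Q W.
clear -B1 Q W.
lia.
Qed.

End StarSums.

Lemma geodesic_distance_star (m : nat) (G : sgraph) : sparse_connected G ->
  let e := #|edges G| in let x := m.+2 in
  geodesic_distance (star_fractal m G) + x * e ^ 2 + m.+1 * x * e
  = 2 * x ^ 2 * geodesic_distance G.
Proof.
move=> sG e x; have := total_distance_star m sG.
rewrite (total_distance_geodesic (proj1 sG)).
by rewrite (total_distance_geodesic (star_connected m sG)) /= -/e -/x; nia.
Qed.

Lemma iter_star_sparse_connected (m t : nat) (G : sgraph) : sparse_connected G ->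
  sparse_connected (iter_star_fractal m t G) /\
  #|edges (iter_star_fractal m t G)| = #|edges G| * m.+2 ^ t.
Proof.
move=> sG; elim: t => [|t [IHs IHe]]; first by rewrite muln1.
split; first exact: star_sparse_connected.
by rewrite /= card_edges_star // IHe expnSr mulnA.
Qed.

(** * The closed form *)

Local Open Scope ring_scope.

Unset Implicit Arguments.

Theorem corollary3 (m : nat) (T : sgraph) (hT : is_tree T) (t : nat)
    (ht : (1 <= t)%N) :
  (geodesic_distance (iter_star_fractal m t T))%:R =
    2 ^+ t * (m%:R + 2) ^+ (2 * t) * (geodesic_distance T)%:R
    - (2 ^+ t - 1) * (m%:R + 2) ^+ (2 * t - 1)
        * (#|T|%:R ^+ 2 - 2 * #|T|%:R + 1)
    - (m%:R + 1) * (#|T|%:R - 1) / 2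
        * ((2 ^+ (t + 1) * (m%:R + 2) ^+ (2 * t) - 2 * (m%:R + 2) ^+ t)
             / (2 * (m%:R + 2) - 1))
  :> rat.
Proof.
have sT := tree_sparse hT.
have m0 : 0 <= m%:R :> rat by apply: ler0n.
have cardT : #|T|%:R = #|edges T|%:R + 1 :> rat by rewrite -(card_edges sT) natr1.
rewrite {}cardT; set e : rat := #|edges T|%:R.
have Em : m%:R + 1 = (m%:R + 2) - 1 :> rat by ring.
rewrite {}Em; set x : rat := m%:R + 2.
have x0 : x != 0 by rewrite /x; lra.
have x1 : 2 * x - 1 != 0 by rewrite /x; lra.
have step s : (geodesic_distance (iter_star_fractal m s.+1 T))%:R =
    2 * x ^+ 2 * (geodesic_distance (iter_star_fractal m s T))%:R
    - x * (e * x ^+ s) ^+ 2 - (x - 1) * x * (e * x ^+ s) :> rat.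
  have [sS eS] := iter_star_sparse_connected m s sT.
  have := congr1 (fun k => k%:R : rat) (geodesic_distance_star m sS).
  have Ex : m.+2%:R = x by rewrite /x -addn2 natrD.
  have Ex1 : m.+1%:R = x - 1 by rewrite /x -addn1 natrD; ring.
  by rewrite /= eS !(natrD, natrM, natrX) -/e !Ex Ex1 => <-; ring.
(* Valid from s = 0 on, with x^(2s) / x in place of x^(2s - 1), whose truncated
   exponent would be wrong at s = 0. *)
have closed s : (geodesic_distance (iter_star_fractal m s T))%:R =
    2 ^+ s * x ^+ s ^+ 2 * (geodesic_distance T)%:R
    - (2 ^+ s - 1) * (x ^+ s ^+ 2 / x) * e ^+ 2
    - (x - 1) * e * (2 ^+ s * x ^+ s ^+ 2 - x ^+ s) / (2 * x - 1).
  elim: s => [|s IHs]; first by rewrite /= !expr0; field; rewrite x0 x1.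
  by rewrite step IHs !exprS; field; rewrite x0 x1.
have E2 : x ^+ (2 * t) = x ^+ t ^+ 2 by rewrite mulnC exprM.
have -> : x ^+ (2 * t - 1) = x ^+ t ^+ 2 / x.
  apply: (mulIf x0); rewrite divfK // -exprSr -E2; congr (_ ^+ _); lia.
by rewrite closed E2 addn1 (exprS 2 t); field; rewrite x0 x1.
Qed.
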